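(* Let $\Sigma=(X,U,F)$ be a system and let $T\subset Q\subset X$. The $(Q,T)$-reachability entropy $h(Q,T)$ equals the smallest average data rate amongst the coder-controllers that can take every state in $Q$ to $T$ in finite time, while never leaving $Q$; i.e. $$h(Q,T)=\inf_{H\in\mathcal{H}(Q,T)}R(H),$$ where $\mathcal{H}(Q,T)$ is the set of $(Q,T)$-admissible coder-controllers and $R(H)$ is the transmission data rate of $H$.
   Context: Notation. $[a;b]$ denotes the set of integers $j$ with $a\le j\le b$, and $[a;b)$ those with $a\le j<b$. $B^A$ is the set of functions $A\to B$. $f:A\rightrightarrows B$ denotes a set-valued map, $f|_M$ restriction to $M$, and $\#A$ the cardinality of $A$. A cover of a set $B$ is a set $\mathcal{A}$ of subsets of $B$ with $B=\bigcup_{A\in\mathcal{A}}A$. Concatenation of sequences is denoted by juxtaposition. System. A system is a triple $\Sigma=(X,U,F)$, where $X,U$ are nonempty sets and $F:X\times U\rightrightarrows X$ is the transition function. For $A\subseteq X$, $F(A,u)=\bigcup_{x\in A}F(x,u)$. $(Q,T)$-reachability. $(Q,T)$-reachability is said to be satisfiable for $\Sigma$ if every state in $Q$ can be taken to the set $T$ in finite time using a finite set of control inputs, while never leaving $Q$. Reach-spanning set. Let $\mathcal{A}$ be a finite cover of $Q\setminus T$ and $G:\bigcup_{t\in\mathbb{Z}_{\ge0}}\mathcal{A}^{[0;t]}\to U$ a map. Consider a set $\mathcal{R}=\{\alpha_1,\dots,\alpha_N\}$, $N\in\mathbb{N}$, where $\alpha_i$ is a sequence of length $\tau_i\in\mathbb{N}$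 (indexed by $[0;\tau_i-1]$) in the power set of $Q$. $\mathcal{R}$ is called $(Q,T)$-reach-spanning in $(\mathcal{A},G)$ if: (1) $Q=\bigcup_{i\in[1;N]}\alpha_i(0)$; (2) only the last element of every sequence is equal to $T$, while all other elements of the sequence do not intersect $T$, i.e. $\alpha_i|_{[0;\tau_i-2]}\in\mathcal{A}^{[0;\tau_i-2]}$ and $\alpha_i(\tau_i-1)=T$; (3) for every $\alpha_i\in\mathcal{R}$ and $t\in[0;\tau_i-2]$, $F(\alpha_i(t),G(\alpha_i|_{[0;t]}))\subseteq\bigcup_{A\in P_{\mathcal{R}}(\alpha_i|_{[0;t]})}A$, where $P_{\mathcal{R}}(\alpha_i|_{[0;t]}):=\{A\in\mathcal{A}\cup\{T\}\mid\exists\,\alpha_k\in\mathcal{R}:\ \alpha_k|_{[0;t]}=\alpha_i|_{[0;t]}\ \wedge\ A=\alpha_k(t+1)\}$. Trivial case (additional convention). For $\mathcal{A}_1=\{Q\setminus T\}$, a fixed $u_1\in U$, and the constant map $G_1(\alpha):=u_1$, the set $\mathcal{R}=\{T\}$ (the single length-one sequence $T$) is also called $(Q,T)$-reach-spanning in $(\mathcal{A}_1,G_1)$ if for every $x\in Q\setminus T$ and every trajectory $\xi_x$ (i.e. every sequence of states with $\xi_x(0)=x$ and $\xi_x(t)\in F(\xi_x(t-1),u_1)$ for all $t\ge1$) there exists $n_{\xi_x}\in\mathbb{N}$ such that $\xi_x(n_{\xi_x})\in T$ and $\xi_x(t)\in Q\setminus T$ for $t\in[0;n_{\xi_x}-1]$.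 Entropy. Let $\hat P_{\mathcal{R}}(\alpha|_{[0;t]}):=P_{\mathcal{R}}(\alpha|_{[0;t]})\setminus\{T\}$ and $\mathcal{R}_0:=\{\alpha(0)\mid\alpha\in\mathcal{R},\ \alpha(0)\neq T\}$. For $\alpha\in\mathcal{R}$ of length $\tau$, let $$\mathcal{B}(\alpha):=\frac{1}{\tau-1}\Big[\sum_{t=0}^{\tau-3}\log_2\#\hat P_{\mathcal{R}}(\alpha|_{[0;t]})+\log_2\#\mathcal{R}_0\Big]\ \text{ if }\tau>1,\qquad \mathcal{B}(\alpha):=0\ \text{ if }\tau=1.$$ Let $\mathcal{N}(\mathcal{R}):=\max_{\alpha\in\mathcal{R}}\mathcal{B}(\alpha)$ and $$r(\mathcal{A},G,Q,T):=\min\{\mathcal{N}(\mathcal{R})\mid\mathcal{R}\text{ is a }(Q,T)\text{-reach-spanning set in }(\mathcal{A},G)\}.$$ The $(Q,T)$-reachability entropy is $h(Q,T):=\inf_{(\mathcal{A},G)}r(\mathcal{A},G,Q,T)$, over all pairs $(\mathcal{A},G)$ consisting of a finite cover $\mathcal{A}$ of $Q\setminus T$ and a map $G:\bigcup_{t\in\mathbb{Z}_{\ge0}}\mathcal{A}^{[0;t]}\to U$. If $(Q,T)$-reachability is not satisfiable for $\Sigma$, $h(Q,T)$ is defined to be infinite. Coder-controllers. A coder at the sensor side encodes the state using a finite coding alphabet $\bar S=S\cup\{s^{\varnothing}\}$ and transmits symbols of $S$ over a noiseless digital channel to the controller. The symbol at time $t$ may depend on all states up to time $t$ and is given by the coder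 function $\gamma:\bigcup_{t\in\mathbb{Z}_{\ge0}}Q^{[0;t]}\to\bar S$. For $\xi\in Q^{[0;t]}$, if $\xi(k)\in T$ then $\gamma(\xi|_{[0;\hat t]}):=s^{\varnothing}$ for all $k\le\hat t\le t$. When the coder generates $s^{\varnothing}$, no symbol is transmitted. Let $\mathcal{Z}$ denote the set of all possible finite-length symbol sequences (of transmitted symbols, in their full length, up to the point where $s^{\varnothing}$ is generated) generated in the closed loop by the coder-controller for initial states in $Q$. At time $t$ the controller has received $t+1$ symbols $s_0\dots s_t$, which determine the control input through the controller function $\delta:\mathcal{Z}\to U$ (also evaluated on the initial segments $s_0\dots s_t$ of such sequences). When no symbol is transmitted, a fixed input is applied by the controller to the system. A $(Q,T)$-admissible coder-controller is a triple $H=(\bar S,\gamma,\delta)$ with compatible coder and controller functions that takes every state in $Q$ to $T$ in finite time without ever leaving $Q$; $\mathcal{H}(Q,T)$ is the set of all of these. Data rate. Let $\hat{\mathcal{Z}}:=\{\omega s^{\varnothing}\mid\omega\in\mathcal{Z}\}$; for $\zeta\in\hat{\mathcal{Z}}$ of length $\tau$, $\zeta(j)\in S$ for $j\in[0;\tau-2]$ and $\zeta(\tau-1)=s^{\varnothing}$ (only an end marker, not transmitted). For $\zeta\in\hat{\mathcal{Z}}$ of length $\tau$ and $t\in[0;\tau-2]$, $Z(\zeta|_{[0;t]})$ is the set of possible successor coder symbols $s\in S$ of $\zeta|_{[0;t]}$ in the closed loop, i.e. of those $s\in S$ such that $\zeta|_{[0;t]}s$ is an initial segment of some element of $\hat{\mathcal{Z}}$.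 For the empty sequence ($\zeta|_{[0;0)}$), $Z(\varnothing):=\{\zeta(0)\mid\zeta\in\mathcal{Z}\}$. The transmission data rate of $H\in\mathcal{H}(Q,T)$ is $$R(H):=\max_{\zeta\in\hat{\mathcal{Z}},\ \tau>1}\frac{1}{\tau-1}\sum_{t=0}^{\tau-2}\log_2\#Z(\zeta|_{[0;t)}),$$ where $\tau$ is the length of $\zeta$. For the trivial coder-controller that does not involve any symbol transmission ($\hat{\mathcal{Z}}=\{s^{\varnothing}\}$), $R(H):=0$.
   Formalization: F is assumed to have nonempty values; admissible coder-controllers must generate only finitely many symbol sequences (finite Z), and the coder may be silent before T is reached only if it never transmits. Without these the equality fails. *)

(* Defs.v *)
From mathcomp Require Import all_boot all_order all_algebra finmap.
From mathcomp Require Import all_classical all_reals all_analysis.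

Set Implicit Arguments.
Unset Strict Implicit.
Unset Printing Implicit Defensive.

Import Order.TTheory GRing.Theory Num.Theory.

Local Open Scope classical_set_scope.
Local Open Scope ring_scope.

(* Trajectories are infinite sequences of states, so the transition map is
   required to have nonempty values.  With empty values a cell with no successor
   satisfies the covering condition of a spanning set vacuously although its
   states never reach the target, and the two quantities compared below differ. *)
Record system := System {
  state : Type;
  input : Type;
  trans : state -> input -> set state;
  state_inhabited : inhabited state;
  input_inhabited : inhabited input;
  trans_nonempty : forall x u, trans x u !=set0 }.

Definition trans_set (Sigma : system) (A : set (state Sigma))
    (u : input Sigma) : set (state Sigma) :=
  \bigcup_(x in A) trans x u.

Definition log2 (R : realType) (x : R) : R := ln x / ln 2.

(* Only used on finite sets; #|` fset_set A| is 0 when A is infinite. *)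
Definition log2card (R : realType) (T : choiceType) (A : set T) : R :=
  log2 (#|` fset_set A|%:R).

Section Trajectories.
Variable Sigma : system.
Local Notation X := (state Sigma).
Local Notation U := (input Sigma).
Implicit Types (Q T : set X) (xi : nat -> X).

Definition trajectory (u : U) xi : Prop :=
  forall t, trans (xi t) u (xi t.+1).

(* A feedback mu maps the state history xi(0), ..., xi(t), that is
   mkseq xi t.+1, to the input applied at time t. *)
Definition closed_loop (mu : seq X -> U) xi : Prop :=
  forall t, trans (xi t) (mu (mkseq xi t.+1)) (xi t.+1).

Definition reaches Q T xi : Prop :=
  exists n, T (xi n) /\ forall t, (t < n)%N -> (Q `\` T) (xi t).

Definition satisfiable Q T : Prop :=
  exists (V : set U) (mu : seq X -> U),
    [/\ finite_set V,
        forall w, V (mu w) &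
        forall xi, Q (xi 0%N) -> closed_loop mu xi -> reaches Q T xi].

End Trajectories.

Section Entropy.
Variables (R : realType) (Sigma : system).
Local Notation X := (state Sigma).
Local Notation U := (input Sigma).
Variables Q T : set X.

Definition finite_cover (B : set X) (AA : set (set X)) : Prop :=
  finite_set AA /\ \bigcup_(A in AA) A = B.

(* A sequence alpha of length tau is a list of size tau, alpha(t) is
   nth set0 alpha t, and alpha|[0;t] is take t.+1 alpha.  The map G is total on
   lists, but only its values on nonempty lists over AA are ever used. *)
Definition successors (AA : set (set X)) (RR : set (seq (set X)))
    (w : seq (set X)) : set (set X) :=
  [set A | (AA A \/ A = T) /\
     exists2 alpha, RR alpha &
       [/\ (size w < size alpha)%N, take (size w) alpha = w &
           A = nth set0 alpha (size w)]].

Definition regular_spanning (AA : set (set X)) (G : seq (set X) -> U)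
    (RR : set (seq (set X))) : Prop :=
  [/\ finite_set RR /\ RR !=set0,
      forall alpha, RR alpha -> (0 < size alpha)%N,
      \bigcup_(alpha in RR) nth set0 alpha 0 = Q,
      forall alpha, RR alpha ->
        (forall t, (t.+1 < size alpha)%N -> AA (nth set0 alpha t)) /\
        nth set0 alpha (size alpha).-1 = T &
      forall alpha t, RR alpha -> (t.+1 < size alpha)%N ->
        trans_set (nth set0 alpha t) (G (take t.+1 alpha)) `<=`
        \bigcup_(A in successors AA RR (take t.+1 alpha)) A].

(* The nonempty lists over {Q \ T} are the lists nseq k.+1 (Q \ T). *)
Definition trivial_spanning (AA : set (set X)) (G : seq (set X) -> U)
    (RR : set (seq (set X))) : Prop :=
  [/\ AA = [set Q `\` T],
      RR = [set [:: T]] &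
      exists2 u : U, forall k, G (nseq k.+1 (Q `\` T)) = u &
        forall xi, (Q `\` T) (xi 0%N) -> trajectory u xi -> reaches Q T xi].

Definition reach_spanning AA G RR : Prop :=
  regular_spanning AA G RR \/ trivial_spanning AA G RR.

Definition proper_successors AA RR w : set (set X) :=
  successors AA RR w `\ T.

Definition initial_cells (RR : set (seq (set X))) : set (set X) :=
  [set A | A <> T /\ exists2 alpha, RR alpha & A = nth set0 alpha 0].

Definition branching (AA : set (set X)) (RR : set (seq (set X)))
    (alpha : seq (set X)) : R :=
  if (1 < size alpha)%N then
    (\sum_(0 <= t < (size alpha).-2)
        log2card R (proper_successors AA RR (take t.+1 alpha))
     + log2card R (initial_cells RR)) / (size alpha).-1%:R
  else 0.

(* The maximum over the finite nonempty set RR. *)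
Definition spanning_rate AA RR : \bar R :=
  ereal_sup [set (branching AA RR alpha)%:E | alpha in RR].

(* An infimum rather than a minimum: delaying in overlapping cells can lower the
   rate of the spanning sets in a fixed (AA, G) strictly and indefinitely. *)
Definition pair_entropy (AA : set (set X)) (G : seq (set X) -> U) : \bar R :=
  ereal_inf [set spanning_rate AA RR | RR in reach_spanning AA G].

Definition reachability_entropy : \bar R :=
  if `[< satisfiable Q T >] then
    ereal_inf [set r | exists AA G,
      finite_cover (Q `\` T) AA /\ r = pair_entropy AA G]
  else +oo%E.

End Entropy.

(* The value None of the coder is the marker of silence; idle_input is the fixed
   input applied when nothing is transmitted. *)
Record coder_controller (X U : Type) := CoderController {
  symbol : finType;
  coder : seq X -> option symbol;
  controller : seq symbol -> U;
  idle_input : U }.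

Section DataRate.
Variables (R : realType) (Sigma : system).
Local Notation X := (state Sigma).
Local Notation U := (input Sigma).
Variables (Q T : set X) (H : coder_controller X U).

Definition history (w : seq X) : Prop := (0 < size w)%N /\ all [in Q] w.

(* In both cases the coder is silent as soon as the target has been visited.
   Before that it transmits at every step, unless it is the trivial coder, which
   never transmits.  Silence before the target would otherwise act as an extra
   symbol that the data rate does not count. *)
Definition compatible_coder : Prop :=
  (forall w, history w -> coder H w = None <-> has [in T] w) \/
  (forall w, history w -> coder H w = None).

Definition transmitted (w : seq X) : seq (symbol H) :=
  pmap (coder H) [seq take k.+1 w | k <- iota 0 (size w)].

Definition feedback (w : seq X) : U :=
  if coder H w is Some _ then controller (transmitted w) else idle_input H.

(* The symbols generated along a closed-loop trajectory before the first
   silence. *)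
Definition symbol_sequences : set (seq (symbol H)) :=
  [set omega | exists2 xi, Q (xi 0%N) /\ closed_loop feedback xi &
     mkseq (fun t => coder H (mkseq xi t.+1)) (size omega).+1 =
     rcons (map Some omega) None].

Definition marked_sequences : set (seq (option (symbol H))) :=
  [set rcons (map Some omega) None | omega in symbol_sequences].

Definition next_symbols (w : seq (option (symbol H))) : set (symbol H) :=
  [set s | exists2 zeta, marked_sequences zeta & prefix (rcons w (Some s)) zeta].

Definition sequence_rate (zeta : seq (option (symbol H))) : R :=
  (\sum_(0 <= t < (size zeta).-1) log2card R (next_symbols (take t zeta)))
  / (size zeta).-1%:R.

(* Sequence rates are nonnegative, so the maximum with 0 only matters when no
   symbol is ever transmitted: the supremum is then -oo and the data rate 0. *)
Definition data_rate : \bar R :=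
  maxe 0%E (ereal_sup [set (sequence_rate zeta)%:E |
    zeta in marked_sequences `&` [set zeta | (1 < size zeta)%N]]).

(* Finitely many symbol sequences: since the alphabet is finite, a transmitting
   coder has a uniform bound on its transmission time, like the finite spanning
   sets; the trivial coder has no such bound, like the trivial spanning set.
   Without it the two sides can differ.  On {0, 1, 2, ...} and two more states
   a, b, with target {0}, let u move n to n - 1 and a to 0, let v move b to 0, and
   let all other moves be the identity: alternating u and v with a single symbol
   succeeds at rate 0, but no spanning set exists. *)
Definition admissible : Prop :=
  [/\ compatible_coder,
      finite_set symbol_sequences &
      forall xi, Q (xi 0%N) -> closed_loop feedback xi -> reaches Q T xi].

End DataRate.

(* Main.v *)
Require Import Defs.
From mathcomp Require Import all_boot all_order all_algebra finmap.
From mathcomp Require Import all_classical all_reals all_analysis.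

(* From a spanning set one builds a coder that tracks a path of cells in the
   tree of prefixes of the spanning set and transmits, at each step, a cell
   containing the current state; the controller applies the map G to the path.
   The symbols that may follow a path are then among its proper successors, and
   a path followed by T is itself an element of the spanning set, so the rates
   compare term by term.

   Conversely, to a nonempty symbol sequence c of a transmitting coder one
   attaches the set of states that can be reached while c is emitted.  Any
   successor of such a state under the input chosen after c is again reached
   along a closed-loop trajectory emitting c, so these sets, selected so that no
   two symbols extending the same sequence give the same cell, form a spanning
   set whose successors are counted by the possible next symbols.

   A silent coder corresponds to the trivial spanning set. *)

Set Implicit Arguments.
Unset Strict Implicit.
Unset Printing Implicit Defensive.

Import Order.TTheory GRing.Theory Num.Theory.

Local Open Scope classical_set_scope.

(** * Monotonicity of logarithms of cardinalities *)

Section Log2Card.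
Local Open Scope ring_scope.
Variable R : realType.

Let ln_nat_ge0 n : 0 <= ln n%:R :> R.
Proof. by case: n => [|n]; [rewrite ln0 | rewrite ln_ge0 // ler1n]. Qed.

Lemma log2card_ge0 (T : choiceType) (A : set T) : 0 <= log2card R A.
Proof.
by rewrite /log2card /log2; apply: divr_ge0; exact: ln_nat_ge0.
Qed.

(** Finiteness of [B] excludes the default cardinal 0 of an infinite set; an empty [A] is harmless
    because [ln] is 0 at 0 and nonnegative on natural numbers. *)
Lemma log2card_le (T U : choiceType) (A : set T) (B : set U) :
  finite_set B -> (A #<= B)%card -> log2card R A <= log2card R B.
Proof.
move=> finB AB.
have leAB : (#|` fset_set A| <= #|` fset_set B|)%N.
  apply: geq_card_fset_set; apply: (card_le_trans AB).
  have [n Bn] := finB.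
  by move: (Bn); rewrite (card_fset_set Bn) card_eq_le => /andP[].
rewrite /log2card /log2; apply: ler_wpM2r.
  by rewrite invr_ge0 ln_nat_ge0.
case: (posnP #|` fset_set A|) => [->|A0].
  by rewrite ln0.
by rewrite ler_ln ?ler_nat // posrE ltr0n // (leq_trans A0).
Qed.

End Log2Card.

(** * Extending and comparing closed-loop runs *)

Section Trajectories.
Variable Sigma : system.
Local Notation X := (state Sigma).
Local Notation U := (input Sigma).

(** Transitions are never empty, so a finite run obeying the feedback can be continued forever. *)
Lemma extend_closed_loop (mu : seq X -> U) (xi : nat -> X) (n : nat) :
  (forall t, t < n -> trans (xi t) (mu (mkseq xi t.+1)) (xi t.+1)) ->
  exists2 xi', closed_loop mu xi' & forall t, t <= n -> xi' t = xi t.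
Proof.
move=> xiP.
(* The recursion carries the whole history, which the feedback reads: [xi] is copied up to time [n],
   and arbitrary successors are chosen afterwards. *)
pose next w : X :=
  if `[< size w <= n /\ w = mkseq xi (size w) >] then xi (size w)
  else projT1 (cid (trans_nonempty (last (xi 0) w) (mu w))).
pose h t := iter t (fun w => rcons w (next w)) [:: xi 0].
pose xi' t := last (xi 0) (h t).
have hE t : h t = mkseq xi' t.+1.
  elim: t => [//|t IH]; rewrite mkseqS -IH /= -/(h t); congr rcons.
  by rewrite /xi' /= last_rcons.
have xi'E t : t <= n -> h t = mkseq xi t.+1.
  elim: t => [//|t IH] tn; rewrite /= -/(h t) (IH (ltnW tn)) [RHS]mkseqS.
  by congr rcons; rewrite /next asboolT size_mkseq.
exists xi' => [t|t tn]; last by rewrite /xi' (xi'E _ tn) mkseqS last_rcons.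
rewrite -hE {2}/xi' /= last_rcons /next; case: asboolP => [[]|_].
  rewrite hE size_mkseq => tn; rewrite -hE xi'E ?(ltnW tn)// => _.
  by rewrite /xi' xi'E ?(ltnW tn)// mkseqS last_rcons -mkseqS; exact: xiP.
by case: cid.
Qed.

(** Only the inputs applied before the target is reached matter. Up to the first disagreement [n] a
    run of [mu1] is one of [mu2]; if its extension under [mu2] reached the target only after [n],
    the two feedbacks would agree at [n]. *)
Lemma reaches_feedback (Q T : set X) (mu1 mu2 : seq X -> U) :
  (forall xi, Q (xi 0) -> closed_loop mu2 xi -> reaches Q T xi) ->
  (forall xi t, Q (xi 0) -> closed_loop mu2 xi ->
    (forall k, k <= t -> (Q `\` T) (xi k)) ->
    mu1 (mkseq xi t.+1) = mu2 (mkseq xi t.+1)) ->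
  forall xi, Q (xi 0) -> closed_loop mu1 xi -> reaches Q T xi.
Proof.
move=> reach2 mu12 xi Q0 xi1.
have [agree|/existsNP ex_diff] :=
  pselect (forall t, mu1 (mkseq xi t.+1) = mu2 (mkseq xi t.+1)).
  by apply: reach2 => // t; rewrite -agree; exact: xi1.
have {}ex_diff : exists t, ~~ `[< mu1 (mkseq xi t.+1) = mu2 (mkseq xi t.+1) >].
  by have [t ?] := ex_diff; exists t; exact/asboolPn.
case: (ex_minnP ex_diff) => n /asboolPn diff min_n.
have [t tn|xi' xi'2 xi'E] := @extend_closed_loop mu2 xi n.
  suff <- : mu1 (mkseq xi t.+1) = mu2 (mkseq xi t.+1) by exact: xi1.
  by apply: contrapT => /asboolPn/min_n; rewrite leqNgt tn.
have Q'0 : Q (xi' 0) by rewrite xi'E.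
have [m [Tm before]] := reach2 _ Q'0 xi'2.
have [mn|nm] := leqP m n.
  exists m; rewrite -xi'E //; split=> // t tm.
  by rewrite -xi'E; [exact: before | exact: leq_trans (ltnW tm) mn].
case: diff.
have <- : mkseq xi' n.+1 = mkseq xi n.+1.
  by apply/eq_in_map => t; rewrite mem_iota ltnS => /xi'E.
by apply: mu12 => // k kn; apply: before; exact: leq_ltn_trans nm.
Qed.

End Trajectories.

(** * Symbols emitted along a trajectory *)

Section Coders.
Variables (R : realType) (Sigma : system).
Local Notation X := (state Sigma).
Local Notation U := (input Sigma).
Variables (Q T : set X) (H : coder_controller X U).
Implicit Types (xi : nat -> X) (c omega : seq (symbol H)).

Definition emits xi c : Prop :=
  mkseq (fun t => coder H (mkseq xi t.+1)) (size c) = map Some c.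

Lemma map_Some_inj (S : Type) : injective (@map S (option S) Some).
Proof. by apply: inj_map => x y []. Qed.

Lemma emits_rcons xi c s :
  emits xi c -> coder H (mkseq xi (size c).+1) = Some s -> emits xi (rcons c s).
Proof.
move=> xic cs; rewrite /emits size_rcons map_rcons -xic -cs.
exact: (mkseqS (fun t => coder H (mkseq xi t.+1))).
Qed.

Lemma emits_take xi c k : emits xi c -> emits xi (take k c).
Proof.
by rewrite /emits map_take => <-; rewrite -map_take take_iota size_take_min.
Qed.

Lemma emits_nth xi c s0 t : emits xi c -> t < size c ->
  coder H (mkseq xi t.+1) = Some (nth s0 c t).
Proof.
move=> xic tc; rewrite -(nth_map s0 None Some tc).
by rewrite -xic nth_mkseq.
Qed.

Lemma emits_transmitted xi c :
  emits xi c -> transmitted H (mkseq xi (size c)) = c.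
Proof.
rewrite /emits => xic.
have pmap_Some f (s : seq (seq X)) c' : map f s = map Some c' -> pmap f s = c'.
  by elim: s c' => [|x s IH] [|y c']//= [-> /IH ->].
apply: pmap_Some; rewrite -xic size_mkseq -map_comp.
apply/eq_in_map => t; rewrite mem_iota => /= tc; congr coder.
by rewrite -map_take take_iota (minn_idPl _).
Qed.

Lemma emits_feedback xi c : emits xi c -> 0 < size c ->
  feedback H (mkseq xi (size c)) = controller c.
Proof.
case: c => // s c xic _; rewrite /feedback (emits_transmitted xic) /=.
by rewrite (emits_nth s xic).
Qed.

Lemma symbol_sequencesP omega :
  symbol_sequences Q omega <->
  exists xi, [/\ Q (xi 0), closed_loop (feedback H) xi, emits xi omega &
    coder H (mkseq xi (size omega).+1) = None].
Proof.
split=> [[xi [Q0 cl]]|[xi [Q0 cl e none]]].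
  by rewrite mkseqS => /rcons_inj[e none]; exists xi.
by exists xi => //; rewrite mkseqS none e.
Qed.

(** The end marker [None] never matches a transmitted symbol, so prefixes can be tested without
    it. *)
Lemma next_symbolsE c : next_symbols Q (map Some c) =
  [set s | exists2 omega, symbol_sequences Q omega & prefix (rcons c s) omega].
Proof.
have prefix_marked c1 c2 :
    prefix (map Some c1) (rcons (map Some c2) None) = prefix c1 c2.
  by elim: c1 c2 => [|s c1 IH] [|s2 c2]//=; rewrite IH.
apply/seteqP; split=> s /=.
  by move=> [_ [omega sym <-]]; rewrite -map_rcons prefix_marked; exists omega.
move=> [omega sym pre]; exists (rcons (map Some omega) None).
  by exists omega.
by rewrite -map_rcons prefix_marked.
Qed.

Lemma sequence_rateE omega :
  sequence_rate R Q (rcons (map Some omega) None) =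
  ((\sum_(0 <= t < size omega)
     log2card R (next_symbols Q (map Some (take t omega)))) /
   (size omega)%:R)%R.
Proof.
rewrite /sequence_rate size_rcons size_map; congr (_ / _)%R.
rewrite !big_nat; apply: eq_bigr => t /= t_lt.
by rewrite -cats1 takel_cat ?map_take// size_map ltnW.
Qed.

Lemma sequence_rate_le_data_rate omega :
  symbol_sequences Q omega -> 0 < size omega ->
  ((sequence_rate R Q (rcons (map Some omega) None))%:E <= data_rate R Q H)%E.
Proof.
move=> sym size_gt0; rewrite /data_rate le_max; apply/orP; right.
apply: ereal_sup_ubound; exists (rcons (map Some omega) None) => //.
by split; [exists omega | rewrite /= size_rcons size_map].
Qed.

Hypothesis TQ : T `<=` Q.
Hypothesis coderT :
  forall w, history Q w -> coder H w = None <-> has [in T] w.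

(** Silence starts exactly at the hitting time [n]. The history up to and including [n] lies in [Q],
    at time [n] because [T] does, so [coderT] applies to it. *)
Lemma coder_before xi n : T (xi n) -> (forall t, t < n -> (Q `\` T) (xi t)) ->
  forall t, t <= n -> coder H (mkseq xi t.+1) = None <-> t = n.
Proof.
move=> Tn before t tn.
have hist : history Q (mkseq xi t.+1).
  split; rewrite ?size_mkseq//; rewrite all_map; apply/allP => k.
  rewrite mem_iota ltnS /= => kt; rewrite in_setE.
  have [kn|nk] := ltnP k n; first exact: (before _ kn).1.
  by have -> : k = n; [apply/eqP; rewrite eqn_leq nk (leq_trans kt)|exact: TQ].
split=> [/(coderT hist)|tE].
  rewrite has_map => /hasP[k]; rewrite mem_iota ltnS /= in_setE => kt Tk.
  apply/eqP; rewrite eqn_leq tn leqNgt; apply/negP => t_lt.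
  by have [] := before _ (leq_ltn_trans kt t_lt).
apply/(coderT hist); rewrite has_map; apply/hasP.
by exists n; [rewrite tE mem_iota ltnS leqnn | rewrite /= in_setE].
Qed.

Lemma emits_upto xi n : T (xi n) -> (forall t, t < n -> (Q `\` T) (xi t)) ->
  exists omega, size omega = n /\ emits xi omega.
Proof.
move=> Tn before.
suff : forall m, m <= n -> exists omega, size omega = m /\ emits xi omega.
  by apply.
elim=> [|m IH] mn; first by exists [::].
have [omega [sz e]] := IH (ltnW mn).
case E : (coder H (mkseq xi m.+1)) => [s|].
  exists (rcons omega s); rewrite size_rcons sz; split=> //.
  by apply: emits_rcons; rewrite ?sz.
by move: (mn); rewrite ((coder_before Tn before (ltnW mn)).1 E) ltnn.
Qed.

Lemma emits_size xi n c : T (xi n) -> (forall t, t < n -> (Q `\` T) (xi t)) ->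
  emits xi c -> size c <= n.
Proof.
move=> Tn before xic; rewrite leqNgt; apply/negP => nc.
have := (coder_before Tn before (leqnn n)).2 erefl.
by case: c xic nc => // s c xic nc; rewrite (emits_nth s xic nc).
Qed.

Lemma symbol_sequence_size xi n omega :
  T (xi n) -> (forall t, t < n -> (Q `\` T) (xi t)) -> emits xi omega ->
  coder H (mkseq xi (size omega).+1) = None -> size omega = n.
Proof.
by move=> Tn before e; move/(coder_before Tn before (emits_size Tn before e)).
Qed.

Lemma emits_eq xi c c' :
  size c = size c' -> emits xi c -> emits xi c' -> c = c'.
Proof. by rewrite /emits => -> -> /map_Some_inj. Qed.

End Coders.

(** * From spanning sets to coders *)

Section SpanningRate.
Variables (R : realType) (Sigma : system).
Variables (T : set (state Sigma)) (AA : set (set (state Sigma))).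

Lemma branching_ge0 RR alpha : (0 <= branching R T AA RR alpha)%R.
Proof.
rewrite /branching; case: ifP => // _; apply: divr_ge0; last exact: ler0n.
by rewrite addr_ge0 ?log2card_ge0// sumr_ge0// => t _; exact: log2card_ge0.
Qed.

Lemma spanning_rate_ge0 RR : RR !=set0 -> (0 <= spanning_rate R T AA RR)%E.
Proof.
move=> [alpha RRalpha].
apply: (@le_trans _ _ (branching R T AA RR alpha)%:E).
  by rewrite lee_fin branching_ge0.
by apply: ereal_sup_ubound; exists alpha.
Qed.

End SpanningRate.

Section RegularSpanning.
Variables (R : realType) (Sigma : system).
Local Notation X := (state Sigma).
Local Notation U := (input Sigma).
Variables (Q T : set X) (AA : set (set X)) (G : seq (set X) -> U).
Variable RR : set (seq (set X)).
Hypothesis span : regular_spanning Q T AA G RR.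

Local Notation ps := (proper_successors T AA RR).

(** A first entry other than [T] is not the last entry of its sequence, hence it belongs to [AA]. *)
Lemma initial_cellsE : initial_cells T RR = ps [::].
Proof.
have [_ size_gt0 _ cells _] := span.
apply/seteqP; split=> A.
  move=> [AT [alpha RRalpha AE]]; split=> //; split; last first.
    by exists alpha => //; rewrite take0; split=> //; exact: size_gt0.
  have [inAA lastT] := cells _ RRalpha.
  have := size_gt0 _ RRalpha; rewrite leq_eqVlt => /orP[/eqP sz|/inAA].
    by case: AT; rewrite AE -lastT -sz.
  by rewrite -AE; left.
by move=> [[_ [alpha RRalpha [_ _ AE]]] AT]; split=> //; exists alpha.
Qed.

(** With the initial cells as the term of the empty prefix, the branching takes the form of a
    sequence rate, which allows a comparison term by term. *)
Lemma branchingE alpha : RR alpha -> branching R T AA RR alpha =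
  ((\sum_(0 <= t < (size alpha).-1) log2card R (ps (take t alpha))) /
   (size alpha).-1%:R)%R.
Proof.
rewrite /branching initial_cellsE.
case: alpha => [|A [|B alpha]] _.
- by rewrite /= big_geq// mul0r.
- by rewrite /= big_geq// mul0r.
by rewrite [in RHS]big_nat_recl// addrC.
Qed.

End RegularSpanning.

Section SpanningCoder.
Variables (R : realType) (Sigma : system).
Local Notation X := (state Sigma).
Local Notation U := (input Sigma).
Variables (Q T : set X) (AA : set (set X)) (G : seq (set X) -> U).
Variable RR : set (seq (set X)).
Hypothesis TQ : T `<=` Q.
Hypothesis cover : finite_cover (Q `\` T) AA.
Hypothesis span : regular_spanning Q T AA G RR.

Local Notation ps := (proper_successors T AA RR).
Implicit Type c : seq (set X).

Let finAA : finite_set AA := cover.1.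

(** These are the inner nodes of the prefix tree of [RR]: the inequality of sizes is strict, so a
    further entry always exists. *)
Definition spanning_node c : Prop :=
  exists2 alpha, RR alpha & size c < size alpha /\ take (size c) alpha = c.

Definition cell_chain c : Prop :=
  forall k, k < size c -> ps (take k c) (nth set0 c k).

(** The possible states once the path [c] has been followed and its input applied; for the empty
    path, the initial states. *)
Let after c (y : X) : Prop :=
  if c is [::] then Q y else exists2 x, last set0 c x & trans x (G c) y.

Lemma cell_before_target A : AA A -> A `<=` Q `\` T.
Proof. by move=> AAA x Ax; rewrite -cover.2; exists A. Qed.

Lemma proper_successors_cell c : ps c `<=` AA.
Proof. by move=> A [[[]]]. Qed.

Lemma cell_chain_cells c : cell_chain c -> forall A, A \in c -> AA A.
Proof.
move=> ch A /(nthP set0)[k k_lt <-].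
exact: proper_successors_cell (ch _ k_lt).
Qed.

Lemma cell_chain_rcons c A : cell_chain c -> ps c A -> cell_chain (rcons c A).
Proof.
move=> ch psA k; rewrite size_rcons ltnS nth_rcons leq_eqVlt => /orP[/eqP->|kc].
  by rewrite ltnn eqxx -cats1 take_size_cat.
by rewrite kc -cats1 takel_cat ?(ltnW kc)//; exact: ch.
Qed.

Lemma spanning_node0 : spanning_node [::].
Proof.
have [[_ [alpha RRalpha]] size_gt0 _ _ _] := span.
by exists alpha => //; rewrite take0; split=> //; exact: size_gt0.
Qed.

(** The last entry of a spanning sequence is [T], so a successor other than [T] is followed by
    another entry. *)
Lemma spanning_node_rcons c A : ps c A -> spanning_node (rcons c A).
Proof.
have [_ _ _ cells _] := span.
move=> [[_ [alpha RRalpha [lt tk AE]]] AT]; exists alpha => //.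
rewrite size_rcons (take_nth set0)// tk -AE; split=> //.
rewrite ltn_neqAle lt andbT; apply/eqP => sz; case: AT.
by rewrite AE -(cells _ RRalpha).2 -sz.
Qed.

(** The covering of [Q] by first entries and the covering of images by successors become one
    statement about [after]. *)
Lemma successor_exists c y :
  spanning_node c -> after c y -> exists2 A, successors T AA RR c A & A y.
Proof.
have [_ size_gt0 covQ cells succ] := span.
move=> node; case: c node => [|A0 c] node /=.
  rewrite -covQ => -[alpha RRalpha y0]; exists (nth set0 alpha 0) => //.
  split; last by exists alpha => //; rewrite take0; split=> //; exact: size_gt0.
  have [inAA lastT] := cells _ RRalpha.
  have := size_gt0 _ RRalpha; rewrite leq_eqVlt => /orP[/eqP sz|/inAA].
    by right; rewrite -lastT -sz.
  by left.
set c' := A0 :: c in node *.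
move=> [x cx xy]; have [alpha RRalpha [lt tk]] := node.
have := succ alpha (size c) RRalpha lt; rewrite -[(size c).+1]/(size c') tk.
move=> /(_ y)[|A ? ?]; last by exists A.
exists x => //; suff -> : nth set0 alpha (size c) = last set0 c' by [].
by rewrite -(nth_last set0 c') -{1}tk nth_take.
Qed.

(** Cells of [AA] avoid [T], so the successor containing [y] is [T] itself; as it is not in [AA], it
    can only be the last entry of its sequence. *)
Lemma chain_end c y : spanning_node c -> after c y -> T y -> RR (rcons c T).
Proof.
have [_ _ _ cells _] := span.
move=> node cy Ty; have [A [AAT [alpha RRalpha [lt tk AE]]] Ay] :=
  successor_exists node cy.
have notAA : ~ AA A by move=> /cell_before_target/(_ y Ay)[].
have AT : A = T by case: AAT.
have [inAA _] := cells _ RRalpha.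
have sz : (size c).+1 = size alpha.
  apply/eqP; rewrite eqn_leq lt leqNgt; apply/negP => /inAA.
  by rewrite -AE.
suff -> : rcons c T = alpha by [].
by rewrite -AT AE -{1}tk -take_nth// sz take_size.
Qed.

Lemma chain_step c y : spanning_node c -> after c y -> ~ T y ->
  exists A, ps c A /\ A y.
Proof.
move=> node cy nTy; have [A sA Ay] := successor_exists node cy.
by exists A; split=> //; split=> // AT; rewrite AT in Ay.
Qed.

Lemma spanning_node_bound : exists N, forall c, spanning_node c -> size c < N.
Proof.
have [[finRR _] _ _ _ _] := span.
exists (\max_(alpha <- fset_set RR) size alpha) => c [alpha RRalpha [lt _]].
apply: (leq_trans lt); apply: leq_bigmax_seq => //.
by rewrite in_fset_set// inE.
Qed.

Let K := fset_set AA.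

Definition choose_cell c (x : X) : set X := xget set0 [set A | ps c A /\ A x].

Definition cell_trace (w : seq X) : seq (set X) :=
  foldl (fun c x => rcons c (choose_cell c x)) [::] w.

(** The alphabet must be a finite type; the extra letter [None] encodes every set that is not a
    cell. *)
Definition encode_cell (A : set X) : option K := insub A.

Definition decode_cell (s : option K) : set X :=
  if s is Some A then val A else set0.

(** The idle input is applied only once the target has been visited, so [G [::]] is an arbitrary
    choice. *)
Definition spanning_coder : coder_controller X U :=
  CoderController
    (fun w => if has [in T] w then None
              else Some (encode_cell (last set0 (cell_trace w))))
    (fun ss => G (map decode_cell ss)) (G [::]).

Local Notation H := spanning_coder.
Local Notation enc c := (map encode_cell c : seq (symbol H)).

Lemma encode_cellK A : AA A -> decode_cell (encode_cell A) = A.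
Proof.
move=> AAA; rewrite /encode_cell; case: insubP => [a _ //|].
by move=> /negP[]; rewrite in_fset_set// inE.
Qed.

Lemma chain_encodeK c : cell_chain c -> map decode_cell (enc c) = c.
Proof.
move=> /cell_chain_cells ch; rewrite -map_comp -[RHS]map_id.
by apply/eq_in_map => A /ch; exact: encode_cellK.
Qed.

Lemma spanning_coder_silent w :
  history Q w -> coder H w = None <-> has [in T] w.
Proof. by move=> _ /=; case: has. Qed.

(** Before the target is visited, the current state lies in a proper successor of the path, so
    [choose_cell] succeeds. The controller then decodes exactly the extended path and applies [G] to
    it, which keeps the next state in [after]. *)
Lemma cell_trace_invariant xi n :
  Q (xi 0) -> closed_loop (feedback H) xi -> (forall t, t < n -> ~ T (xi t)) ->
  let c := cell_trace (mkseq xi n) in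
  [/\ size c = n, spanning_node c, cell_chain c, after c (xi n) &
      emits xi (enc c)].
Proof.
move=> Q0 cl; elim: n => [|n IH] nT; first by split=> //; exact: spanning_node0.
have [|/= sz node ch cy e] := IH; first by move=> t /ltnW; exact: nT.
rewrite mkseqS /cell_trace foldl_rcons -/(cell_trace _).
set c := cell_trace (mkseq xi n) in sz node ch cy e *; set A := choose_cell c _.
have [psA Axn] : ps c A /\ A (xi n).
  apply: (@xgetPex _ set0 [set A | ps c A /\ A (xi n)]).
  by apply: chain_step => //; exact: nT.
have chA := cell_chain_rcons ch psA.
have eA : emits xi (enc (rcons c A)).
  rewrite map_rcons; apply: emits_rcons => //.
  rewrite size_map sz.
  have -> w : coder H w = if has [in T] w then None
      else Some (encode_cell (last set0 (cell_trace w))) by [].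
  rewrite ifN; last first.
    rewrite has_map; apply/hasPn => t; rewrite mem_iota => /= tn.
    by apply/negP; rewrite in_setE; exact: nT.
  by rewrite mkseqS /cell_trace foldl_rcons -/(cell_trace _) last_rcons.
split=> //; first by rewrite size_rcons sz.
- exact: spanning_node_rcons.
- have -> : after (rcons c A) = fun y =>
      exists2 x, last set0 (rcons c A) x & trans x (G (rcons c A)) y.
    by case: (c).
  exists (xi n); first by rewrite last_rcons.
  have fb : feedback H (mkseq xi n.+1) = G (rcons c A).
    have szA : size (enc (rcons c A)) = n.+1 by rewrite size_map size_rcons sz.
    by rewrite -szA emits_feedback ?szA//= chain_encodeK.
  by rewrite -fb; exact: cl.
Qed.

Lemma spanning_coder_reaches xi :
  Q (xi 0) -> closed_loop (feedback H) xi -> reaches Q T xi.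
Proof.
move=> Q0 cl.
have ex_T : exists n, `[< T (xi n) >].
  (* A run that never met [T] would trace nodes of every length, against the finiteness of [RR]. *)
  apply/not_existsP => nT; have [N nodeN] := spanning_node_bound.
  have [|/= sz /nodeN] := @cell_trace_invariant xi N Q0 cl.
    by move=> t _ Tt; apply: (nT t); exact/asboolP.
  by rewrite sz ltnn.
case: (ex_minnP ex_T) => n /asboolP Tn min_n; exists n; split=> // t tn.
have nT k : k < n -> ~ T (xi k).
  by move=> kn Tk; move: kn; rewrite ltnNge min_n//; exact/asboolP.
have [|/= _ _ ch _ _] := @cell_trace_invariant xi t.+1 Q0 cl.
  by move=> k kt; apply: nT; exact: leq_ltn_trans tn.
have [|/= sz node ch' cy _] := @cell_trace_invariant xi t Q0 cl.
  by move=> k kt; apply: nT; exact: ltn_trans tn.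
have [A [psA Ax]] := chain_step node cy (nT _ tn).
exact: cell_before_target (proper_successors_cell psA) _ Ax.
Qed.

(** Both [omega] and the encoded trace are emitted by the same run and have the hitting time as
    length, so they coincide. *)
Lemma spanning_symbol_sequences (omega : seq (symbol H)) :
  symbol_sequences Q omega ->
  exists c, [/\ omega = enc c, cell_chain c & RR (rcons c T)].
Proof.
move=> /symbol_sequencesP[xi [Q0 cl e none]].
have [n [Tn before]] := spanning_coder_reaches Q0 cl.
have [|/= sz node ch cy e'] := @cell_trace_invariant xi n Q0 cl.
  by move=> t /before[].
exists (cell_trace (mkseq xi n)); split=> //; last exact: chain_end Tn.
apply: (emits_eq _ e e'); rewrite size_map sz.
exact: (symbol_sequence_size TQ spanning_coder_silent Tn before).
Qed.

Lemma spanning_coder_admissible : admissible Q T H.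
Proof.
have [[finRR _] _ _ _ _] := span.
split; [by left; exact: spanning_coder_silent | |exact: spanning_coder_reaches].
(* Dropping the final [T] and encoding maps the finite set [RR] onto a set containing all symbol
   sequences. *)
pose f (alpha : seq (set X)) := enc (take (size alpha).-1 alpha).
apply: (@sub_finite_set _ _ (f @` RR)); last exact: finite_image.
move=> omega /spanning_symbol_sequences[c [-> _ RRc]]; exists (rcons c T) => //.
by rewrite /f size_rcons -cats1 take_size_cat.
Qed.

(** A next symbol encodes the next cell of some chain [c']; encoding is invertible on chains, so
    [c'] agrees with [c] up to [t]. Decoding thus injects next symbols into proper successors. *)
Lemma spanning_next_symbols c t : cell_chain c -> t <= size c ->
  (next_symbols Q (map Some (take t (enc c))) #<= ps (take t c))%card.
Proof.
move=> ch tc; rewrite next_symbolsE; set N := mkset _.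
have NP s : N s ->
    s = encode_cell (decode_cell s) /\ ps (take t c) (decode_cell s).
  move=> [_ /spanning_symbol_sequences[c' [-> ch' _]]].
  rewrite prefixE => /eqP.
  rewrite size_rcons size_take_min size_map (minn_idPl tc).
  have [tc'|c't] := ltnP t (size c'); last first.
    move=> /(congr1 size).
    rewrite size_rcons !size_take_min !size_map (minn_idPl tc).
    by rewrite (minn_idPr (leqW c't)) => c'E; move: c't; rewrite c'E ltnn.
  rewrite (take_nth (encode_cell set0)) ?size_map// => /rcons_inj[tk <-].
  rewrite (nth_map set0)// encode_cellK; last first.
    by apply: (cell_chain_cells ch'); exact: mem_nth.
  split=> //; suff <- : take t c' = take t c by exact: ch'.
  rewrite -(chain_encodeK ch) -(chain_encodeK ch').
  by rewrite -[LHS]map_take -[RHS]map_take tk.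
have inj : {in N &, injective decode_cell}.
  move=> s1 s2 /set_mem/NP[e1 _] /set_mem/NP[e2 _] e12.
  by rewrite e1 e12 -e2.
rewrite -(card_le_eql (inj_card_eq inj)); apply: subset_card_le.
by move=> _ [s /NP[_ ?] <-].
Qed.

Lemma spanning_coder_rate : (data_rate R Q H <= spanning_rate R T AA RR)%E.
Proof.
have [[_ RR0] _ _ _ _] := span.
rewrite /data_rate ge_max spanning_rate_ge0//=.
apply: ge_ereal_sup => _ [_ [[omega sym <-] _] <-].
have [c [omegaE ch RRc]] := spanning_symbol_sequences sym.
apply: (@le_trans _ _ (branching R T AA RR (rcons c T))%:E); last first.
  by apply: ereal_sup_ubound; exists (rcons c T).
rewrite lee_fin (branchingE R span RRc) sequence_rateE.
rewrite size_rcons omegaE size_map/=.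
apply: ler_wpM2r; first by rewrite invr_ge0 ler0n.
rewrite !big_nat; apply: ler_sum => t /= t_lt.
apply: log2card_le.
  by apply: sub_finite_set finAA; exact: proper_successors_cell.
rewrite -cats1 takel_cat; last exact: ltnW.
by apply: spanning_next_symbols => //; exact: ltnW.
Qed.

End SpanningCoder.

(** * Silent coders and the trivial spanning set *)

Section SilentCoders.
Variables (R : realType) (Sigma : system).
Local Notation X := (state Sigma).
Local Notation U := (input Sigma).
Variables Q T : set X.

Definition silent_coder (u : U) : coder_controller X U :=
  @CoderController X U unit (fun _ => None) (fun _ => u) u.

Lemma silent_symbol_sequences (u : U)
  (omega : seq (symbol (silent_coder u))) :
  symbol_sequences Q omega -> omega = [::].
Proof.
by move=> /symbol_sequencesP[xi [_ _ e _]]; case: omega e.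
Qed.

Lemma silent_data_rate (u : U) : data_rate R Q (silent_coder u) = 0%E.
Proof.
rewrite /data_rate (_ : _ `&` _ = set0) ?image_set0 ?ereal_sup0.
  by rewrite max_l// leNye.
by apply/seteqP; split=> // _ [[omega /silent_symbol_sequences -> <-]].
Qed.

Lemma silent_coder_admissible (AA : set (set X)) (G : seq (set X) -> U)
    (RR : set (seq (set X))) :
  trivial_spanning Q T AA G RR -> exists u, admissible Q T (silent_coder u).
Proof.
move=> [_ _ [u _ reach]]; exists u; split; first by right.
  apply: (@sub_finite_set _ _ [set [::]]); last exact: finite_set1.
  by move=> omega /silent_symbol_sequences.
move=> xi Q0 cl; have [T0|nT0] := pselect (T (xi 0)).
  by exists 0.
by apply: reach => // t; exact: cl.
Qed.

(** Silence is known only for histories in [Q], but these are the only ones met before the target,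
    where the feedback is therefore the idle input. *)
Lemma silent_trivial_spanning (H : coder_controller X U) :
  (forall w, history Q w -> coder H w = None) ->
  (forall xi, Q (xi 0) -> closed_loop (feedback H) xi -> reaches Q T xi) ->
  trivial_spanning Q T [set Q `\` T] (fun _ => idle_input H) [set [:: T]].
Proof.
move=> silent reach; split=> //; exists (idle_input H) => // xi [Q0 _] xiP.
apply: (reaches_feedback (mu1 := fun _ => idle_input H) reach) => //.
move=> xi' t _ _ before; rewrite /feedback silent//.
split; first by rewrite size_mkseq.
rewrite all_map; apply/allP => k; rewrite mem_iota ltnS /= => kt.
by rewrite in_setE; have [] := before _ kt.
Qed.

End SilentCoders.

(** * From coders to spanning sets *)

Section CoderSpanning.
Variables (R : realType) (Sigma : system).
Local Notation X := (state Sigma).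
Local Notation U := (input Sigma).
Variables (Q T : set X) (H : coder_controller X U).
Hypothesis TQ : T `<=` Q.
Hypothesis coderT :
  forall w, history Q w -> coder H w = None <-> has [in T] w.
Hypothesis finite_symbols : finite_set (@symbol_sequences _ Q H).
Hypothesis reach :
  forall xi, Q (xi 0) -> closed_loop (feedback H) xi -> reaches Q T xi.
Implicit Types (c omega : seq (symbol H)).

(** The first symbol is emitted at time 0, so the last symbol of a nonempty [c] is emitted at time
    [(size c).-1]. *)
Definition emission_cell c : set X :=
  [set x | exists xi, [/\ Q (xi 0), closed_loop (feedback H) xi,
    emits xi c & x = xi (size c).-1]].

Definition emission_cells c : seq (set X) :=
  [seq emission_cell (take k.+1 c) | k <- iota 0 (size c)].

Let after c (y : X) : Prop :=
  if c is [::] then Q y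
  else exists2 x, emission_cell c x & trans x (controller c) y.

Lemma size_emission_cells c : size (emission_cells c) = size c.
Proof. by rewrite size_map size_iota. Qed.

Lemma nth_emission_cells c k : k < size c ->
  nth set0 (emission_cells c) k = emission_cell (take k.+1 c).
Proof. by move=> kc; rewrite (nth_map 0) ?size_iota// nth_iota. Qed.

Lemma take_emission_cells c k :
  take k (emission_cells c) = emission_cells (take k c).
Proof.
rewrite /emission_cells -map_take take_iota size_take_min; apply/eq_in_map => j.
by rewrite mem_iota leq_min => /= /andP[jk _]; rewrite take_takel.
Qed.

Lemma emission_cells_rcons c s : emission_cells (rcons c s) =
  rcons (emission_cells c) (emission_cell (rcons c s)).
Proof.
rewrite -[LHS](cat_take_drop (size c)) take_emission_cells.
rewrite -cats1 take_size_cat//.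
rewrite -[in RHS]cats1; congr cat.
rewrite (drop_nth set0); last by rewrite size_emission_cells size_cat addn1.
rewrite drop_oversize; last by rewrite size_emission_cells size_cat addn1.
by rewrite nth_emission_cells ?size_cat ?addn1// take_oversize// size_cat addn1.
Qed.

(** Each state of the cell of [c] has a history that emits [c], and the input then applied,
    [controller c], depends on [c] alone. Hence any successor [y] can be appended to such a history
    and the run extended. *)
Lemma after_emission c y : after c y -> exists xi,
  [/\ Q (xi 0), closed_loop (feedback H) xi, emits xi c & xi (size c) = y].
Proof.
case: c => [|s c] /=.
  move=> Qy; have [//|xi cl xi0] :=
    @extend_closed_loop _ (feedback H) (fun _ => y) 0.
  by exists xi; split; rewrite ?xi0.
set c' := s :: c => -[_ [xi [Q0 cl e ->]] xy].
(* Only the values up to time [size c'] survive the extension. *)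
pose xi1 t := if t < size c' then xi t else y.
have xi1E n : n <= size c' -> mkseq xi1 n = mkseq xi n.
  move=> nc; apply/eq_in_map => t; rewrite mem_iota => /= tn.
  by rewrite /xi1 (leq_trans tn).
have [t tc|xi2 cl2 xi2E] := @extend_closed_loop _ (feedback H) xi1 (size c').
  rewrite xi1E// {1}/xi1 tc /xi1; case: ltnP => [_|ct]; first exact: cl.
  have tE : t.+1 = size c' by apply/eqP; rewrite eqn_leq tc ct.
  by rewrite tE emits_feedback// (_ : t = (size c').-1) // -tE.
have mkE n : n <= size c' -> mkseq xi2 n = mkseq xi n.
  move=> nc; rewrite -xi1E//; apply/eq_in_map => t; rewrite mem_iota => /= tn.
  by apply: xi2E; apply: leq_trans nc; exact: ltnW.
exists xi2; split=> //; first by rewrite xi2E.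
- rewrite /emits -e; apply/eq_in_map => t; rewrite mem_iota => /= tc.
  by rewrite mkE.
- by rewrite xi2E// /xi1 ltnn.
Qed.

Lemma symbol_sequence_end c y : after c y -> T y -> symbol_sequences Q c.
Proof.
move=> /after_emission[xi [Q0 cl e xiy]] Ty.
have [n [Tn before]] := reach Q0 cl.
have cn := emits_size TQ coderT Tn before e.
have cE : size c = n.
  apply/eqP; rewrite eqn_leq cn leqNgt; apply/negP => /before[_].
  by rewrite xiy.
apply/symbol_sequencesP; exists xi; split=> //.
exact/(coder_before TQ coderT Tn before cn).
Qed.

Lemma emission_step c y : after c y -> ~ T y ->
  exists s, emission_cell (rcons c s) y.
Proof.
move=> /after_emission[xi [Q0 cl e xiy]] nTy.
have [n [Tn before]] := reach Q0 cl.
have cn := emits_size TQ coderT Tn before e.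
case E : (coder H (mkseq xi (size c).+1)) => [s|].
  by exists s, xi; split=> //; [exact: emits_rcons | rewrite size_rcons].
by move/(coder_before TQ coderT Tn before cn): E => cE; rewrite -cE xiy in Tn.
Qed.

Lemma emission_cell_sub c : 0 < size c -> emission_cell c `<=` Q `\` T.
Proof.
move=> c_gt0 _ [xi [Q0 cl e ->]]; have [n [Tn before]] := reach Q0 cl.
apply: (before); apply: leq_trans (emits_size TQ coderT Tn before e).
by rewrite prednK.
Qed.

(** A run emitting [c] emits a complete symbol sequence at least as long, and there are finitely
    many of those. *)
Lemma emission_bound : exists N, forall c y, after c y -> size c <= N.
Proof.
exists (\max_(omega <- fset_set (@symbol_sequences _ Q H)) size omega) => c y.
move=> /after_emission[xi [Q0 cl e _]]; have [n [Tn before]] := reach Q0 cl.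
have [omega [sz e']] := emits_upto TQ coderT Tn before.
apply: (leq_trans (emits_size TQ coderT Tn before e)); rewrite -sz.
apply: leq_bigmax_seq => //; rewrite in_fset_set// inE.
apply/symbol_sequencesP; exists xi; split=> //.
by apply/(coder_before TQ coderT Tn before); rewrite sz.
Qed.

(* Distinct symbols may lead to the same cell, whereas the maps of a spanning
   set only see cells.  One symbol per cell suffices, because the inputs and
   cells following a symbol sequence c serve every state of the cell of c. *)
Definition select_symbol c (A : set X) : seq (symbol H) :=
  if [pick s | `[< emission_cell (rcons c s) = A >]] is Some s
  then rcons c s else c.

Definition selected_symbols (w : seq (set X)) : seq (symbol H) :=
  foldl select_symbol [::] w.

(** These are the symbol sequences that can be recovered from their cells, so that a map on paths of
    cells can evaluate the controller on them. *)
Definition selected c : Prop := selected_symbols (emission_cells c) = c.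

Lemma size_selected_symbols w : size (selected_symbols w) <= size w.
Proof.
elim/last_ind: w => // w A IH; rewrite /selected_symbols foldl_rcons.
rewrite -/(selected_symbols w) /select_symbol; case: pickP => [s _|_].
  by rewrite !size_rcons ltnS.
by rewrite size_rcons (leq_trans IH).
Qed.

(** Were no symbol found for the last cell, the recovered sequence would be too short. *)
Lemma selected_belast c s : selected (rcons c s) -> selected c.
Proof.
rewrite /selected emission_cells_rcons /selected_symbols foldl_rcons.
rewrite -/(selected_symbols _) /select_symbol.
case: pickP => [s' _ /rcons_inj[]//|_ E].
have := size_selected_symbols (emission_cells c).
by rewrite E size_rcons size_emission_cells ltnn.
Qed.

Lemma selected_take c k : selected c -> selected (take k c).
Proof.
elim/last_ind: c => [//|c s IH] sel; have [kc|ck] := leqP k (size c).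
  by rewrite -cats1 takel_cat//; exact/IH/(selected_belast sel).
by rewrite take_oversize// size_rcons.
Qed.

Lemma selected_step c y : selected c -> after c y -> ~ T y ->
  exists s, selected (rcons c s) /\ emission_cell (rcons c s) y.
Proof.
move=> sel cy /(emission_step cy)[s0 ys0].
have : selected_symbols
         (rcons (emission_cells c) (emission_cell (rcons c s0))) =
       select_symbol c (emission_cell (rcons c s0)).
  by rewrite /selected_symbols foldl_rcons -/(selected_symbols _) sel.
rewrite /select_symbol; case: pickP => [s /asboolP sE|/(_ s0)/asboolP//] E.
by exists s; split; rewrite ?sE// /selected emission_cells_rcons sE.
Qed.

(** Follow a state: while it is outside [T], append a selected symbol whose cell contains it and
    move to any successor. The bound on emissions forces this to end in [T], at a complete symbol
    sequence. *)
Lemma selected_completion c y : selected c -> after c y ->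
  exists omega, [/\ symbol_sequences Q omega, selected omega,
    take (size c) omega = c, (T y -> omega = c) &
    (~ T y -> size c < size omega /\
              emission_cell (take (size c).+1 omega) y)].
Proof.
have [N boundN] := emission_bound.
have [m] := ubnP (N - size c); elim: m c y => // m IH c y; rewrite ltnS => Nm.
move=> sel cy; have [Ty|nTy] := pselect (T y).
  exists c; split=> //; [exact: symbol_sequence_end cy Ty|exact: take_size].
have [s [sel' ys]] := selected_step sel cy nTy.
have [y' yy'] := trans_nonempty y (controller (rcons c s)).
have cy' : after (rcons c s) y'.
  by rewrite /after; case E : (rcons c s) => [|s' c'];
    [case: (c) E | rewrite -E; exists y].
have := boundN _ _ cy'; rewrite size_rcons => cN.
have [|omega [sym selo tk _ _]] := IH (rcons c s) y' _ sel' cy'.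
  by rewrite size_rcons; apply: leq_trans Nm; rewrite ltn_sub2l.
rewrite size_rcons in tk.
have co : size c < size omega.
  move: (congr1 size tk); rewrite size_rcons size_take_min => <-.
  exact: geq_minr.
exists omega; split=> // [|_]; last by rewrite tk.
by rewrite -(@take_takel _ _ (size c).+1)// tk -cats1 take_size_cat.
Qed.

Definition emission_cover : set (set X) :=
  \bigcup_(omega in @symbol_sequences _ Q H) [set` emission_cells omega].

Definition emission_input (w : seq (set X)) : U :=
  controller (selected_symbols w).

(** The sequence [[:: T]] covers the states of [T] and keeps the set nonempty even for empty [Q];
    its branching is 0. *)
Definition emission_spanning : set (seq (set X)) :=
  [set rcons (emission_cells omega) T |
    omega in @symbol_sequences _ Q H `&` selected] `|` [set [:: T]].

Lemma emission_spanningP alpha : emission_spanning alpha ->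
  exists omega, [/\ alpha = rcons (emission_cells omega) T, selected omega &
    omega = [::] \/ symbol_sequences Q omega].
Proof.
case=> [[omega [sym sel] <-]|->]; first by exists omega; split=> //; right.
by exists [::]; split=> //; left.
Qed.

Lemma emission_coverP omega k : symbol_sequences Q omega -> k < size omega ->
  emission_cover (emission_cell (take k.+1 omega)).
Proof.
move=> sym ko; exists omega => //=; rewrite -nth_emission_cells//.
by apply: mem_nth; rewrite size_emission_cells.
Qed.

Lemma emission_cover_finite : finite_cover (Q `\` T) emission_cover.
Proof.
split; first by apply: bigcup_finite => // omega _; exact: finite_seq.
apply/seteqP; split=> [y [A [omega _ /mapP[k]]]|y [Qy nTy]].
  rewrite mem_iota => /= ko -> ; apply: emission_cell_sub.
  by rewrite size_takel.
have [|omega [sym _ _ _ /(_ nTy)[sz yo]]] := @selected_completion [::] y _ Qy.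
  by [].
by exists (emission_cell (take 1 omega)) => //; exact: emission_coverP.
Qed.

Lemma emission_regular_spanning :
  regular_spanning Q T emission_cover emission_input emission_spanning.
Proof.
split.
- split; last by exists [:: T]; right.
  rewrite finite_setU; split; last exact: finite_set1.
  by apply: finite_image; apply: sub_finite_set finite_symbols => ? [].
- by move=> _ /emission_spanningP[omega [-> _ _]]; rewrite size_rcons.
- apply/seteqP; split=> [y [_ /emission_spanningP[omega [-> _ _]]]|y Qy].
    case: omega => [|s omega] /=; first exact: TQ.
    by move=> /emission_cell_sub[].
  have [Ty|nTy] := pselect (T y); first by exists [:: T] => //; right.
  have [|omega [sym sel _ _ /(_ nTy)[sz yo]]] :=
    @selected_completion [::] y _ Qy.
    by [].
  exists (rcons (emission_cells omega) T); first by left; exists omega.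
  by rewrite nth_rcons size_emission_cells sz nth_emission_cells.
- move=> _ /emission_spanningP[omega [-> _ sym]].
  rewrite nth_last last_rcons size_rcons size_emission_cells.
  split=> // t; rewrite ltnS => t_lt.
  rewrite nth_rcons size_emission_cells t_lt nth_emission_cells//.
  apply: emission_coverP => //; case: sym => // omega0.
  by rewrite omega0 in t_lt.
- move=> _ t /emission_spanningP[omega [-> sel sym]].
  rewrite size_rcons size_emission_cells ltnS => t_lt.
  rewrite nth_rcons size_emission_cells t_lt nth_emission_cells//.
  rewrite -cats1 takel_cat ?size_emission_cells// take_emission_cells.
  have szc : size (take t.+1 omega) = t.+1 by rewrite size_takel.
  have selc := selected_take t.+1 sel.
  move: (take t.+1 omega) szc selc => c szc selc y [x cx].
  rewrite /emission_input selc => xy.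
  have cy : after c y by case: c szc {selc} cx xy => // s c _ cx xy; exists x.
  have [omega' [sym' sel' tk' yT ynT]] := selected_completion selc cy.
  (* The completion [omega'] of [c] from [y] has the same cells as [c] so far, so its next entry is
     a successor: a cell containing [y], or [T] if [y] is in [T]. *)
  have succ : size c <= size omega' -> successors T emission_cover
      emission_spanning (emission_cells c)
      (nth set0 (rcons (emission_cells omega') T) (size c)).
    move=> co; split.
      rewrite nth_rcons size_emission_cells.
      case: ltnP => [co'|o'c]; last by rewrite eqn_leq co o'c; right.
      by left; rewrite nth_emission_cells//; exact: emission_coverP.
    exists (rcons (emission_cells omega') T); first by left; exists omega'.
    rewrite size_rcons !size_emission_cells; split=> //.
    by rewrite -cats1 takel_cat ?size_emission_cells// take_emission_cells tk'.
  have [Ty|nTy] := pselect (T y).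
    rewrite (yT Ty) in succ; exists T => //.
    by have := succ (leqnn _); rewrite nth_rcons size_emission_cells ltnn eqxx.
  have [co yo] := ynT nTy.
  exists (emission_cell (take (size c).+1 omega')) => //.
  have := succ (ltnW co).
  by rewrite nth_rcons size_emission_cells co nth_emission_cells.
Qed.

(** The proper successors lie in the image of the next symbols under the map sending [s] to the cell
    of [rcons c s]. *)
Lemma emission_proper_successors c : selected c ->
  (proper_successors T emission_cover emission_spanning (emission_cells c) #<=
   next_symbols Q (map Some c))%card.
Proof.
move=> sel; set N := next_symbols _ _.
apply: card_le_trans (card_image_le (fun s => emission_cell (rcons c s)) N).
apply: subset_card_le => A [[_ [_ /emission_spanningP[omega [-> selo sym]]]]].
rewrite size_rcons !size_emission_cells ltnS => -[co tk AE] AT.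
(* Both sequences are selected, so equal cells give equal symbols. *)
have {}tk : take (size c) omega = c.
  rewrite -[RHS]sel -[in RHS]tk -cats1 takel_cat ?size_emission_cells//.
  by rewrite take_emission_cells (selected_take (size c) selo).
have {}co : size c < size omega.
  rewrite ltn_neqAle co andbT; apply/eqP => sz; apply: AT; rewrite /= AE.
  by rewrite nth_rcons size_emission_cells sz ltnn eqxx.
have {}sym : symbol_sequences Q omega.
  by case: sym => // omega0; rewrite omega0 in co.
rewrite AE nth_rcons size_emission_cells co nth_emission_cells//.
have [s0 _] : exists s : symbol H, True by case: (omega) co => // s *; exists s.
exists (nth s0 omega (size c)).
  rewrite /N next_symbolsE; exists omega => //.
  by rewrite prefixE size_rcons (take_nth s0)// tk.
by rewrite (take_nth s0)// tk.
Qed.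

Lemma emission_spanning_rate :
  (spanning_rate R T emission_cover emission_spanning <= data_rate R Q H)%E.
Proof.
apply: ge_ereal_sup => _ [alpha RRalpha <-].
rewrite (branchingE R emission_regular_spanning RRalpha).
(* Without symbols the branching is an empty sum, bounded by the maximum with 0 in [data_rate]. *)
have [omega [-> sel [->|sym]]] := emission_spanningP RRalpha.
  by rewrite big_geq// mul0r /data_rate le_max lexx.
have [sz0|sz_gt0] := posnP (size omega).
  by rewrite (size0nil sz0) big_geq// mul0r /data_rate le_max lexx.
apply: le_trans (sequence_rate_le_data_rate R sym sz_gt0).
rewrite sequence_rateE lee_fin size_rcons size_emission_cells/=.
apply: ler_wpM2r; first by rewrite invr_ge0 ler0n.
rewrite !big_nat; apply: ler_sum => t /= t_lt.
rewrite -cats1 takel_cat ?size_emission_cells ?(ltnW t_lt)//.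
rewrite take_emission_cells.
apply: log2card_le; first exact: finite_finset.
exact/emission_proper_successors/selected_take.
Qed.

End CoderSpanning.

(** * Comparison of the two infima *)

Section Admissible.
Variables (R : realType) (Sigma : system).
Local Notation X := (state Sigma).
Local Notation U := (input Sigma).
Variables Q T : set X.
Hypothesis TQ : T `<=` Q.

(** The feedback of [H] may take infinitely many values on arbitrary histories, but only finitely
    many along runs before the target; all other values are replaced by the idle input. *)
Lemma admissible_satisfiable (H : coder_controller X U) :
  admissible Q T H -> satisfiable Q T.
Proof.
move=> [coderQ finite_symbols reach].
(* The inputs applied after prefixes of the finitely many symbol sequences, and the idle input. *)
pose V : set U := idle_input H |` @controller _ _ H @`
  \bigcup_(omega in @symbol_sequences _ Q H)
    [set` [seq take k omega | k <- iota 0 (size omega).+1]].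
pose mu w := if `[< V (feedback H w) >] then feedback H w else idle_input H.
exists V, mu; split.
- rewrite finite_setU; split; first exact: finite_set1.
  by apply/finite_image/bigcup_finite => // omega _; exact: finite_seq.
- by move=> w; rewrite /mu; case: asboolP => // _; left.
apply: (reaches_feedback reach) => xi t Q0 cl before; rewrite /mu asboolT//.
case: coderQ => [coderT|silent]; last first.
  left; rewrite /feedback silent//; split; first by rewrite size_mkseq.
  rewrite all_map; apply/allP => k; rewrite mem_iota ltnS /= => kt.
  by rewrite in_setE; have [] := before _ kt.
right; have [n [Tn beforen]] := reach _ Q0 cl.
have tn : t < n by rewrite ltnNge; apply/negP => /before[].
have [omega [sz e]] := emits_upto TQ coderT Tn beforen.
have szt : size (take t.+1 omega) = t.+1 by rewrite size_takel ?sz.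
exists (take t.+1 omega); last first.
  by rewrite -{2}szt (emits_feedback (emits_take t.+1 e)) ?szt.
exists omega.
  apply/symbol_sequencesP; exists xi; split=> //.
  by apply/(coder_before TQ coderT Tn beforen); rewrite sz.
by apply/mapP; exists t.+1; rewrite // mem_iota ltnS sz.
Qed.

Lemma reachability_entropy_le_data_rate (H : coder_controller X U) :
  admissible Q T H -> (reachability_entropy R Q T <= data_rate R Q H)%E.
Proof.
move=> adm; rewrite /reachability_entropy asboolT; last first.
  exact: admissible_satisfiable adm.
suff [AA [G [RR [cover span rate]]]] : exists AA G RR,
    [/\ finite_cover (Q `\` T) AA, reach_spanning Q T AA G RR &
      (spanning_rate R T AA RR <= data_rate R Q H)%E].
  apply: le_trans rate; apply: (@le_trans _ _ (pair_entropy R Q T AA G)).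
    by apply: ereal_inf_lbound; exists AA, G.
  by apply: ereal_inf_lbound; exists RR.
case: adm => -[coderT|silent] finite_symbols reach.
  exists (@emission_cover _ Q H), (@emission_input _ Q H),
    (@emission_spanning _ Q T H); split.
  - exact: emission_cover_finite.
  - by left; exact: emission_regular_spanning.
  - exact: emission_spanning_rate.
exists [set Q `\` T], (fun _ => idle_input H), [set [:: T]]; split.
- by split; [exact: finite_set1 | rewrite bigcup_set1].
- by right; exact: silent_trivial_spanning.
rewrite /spanning_rate image_set1 ereal_sup1 /branching/=.
by rewrite /data_rate le_max lexx.
Qed.

Lemma data_rate_le_spanning_rate AA (G : seq (set X) -> U) RR :
  finite_cover (Q `\` T) AA -> reach_spanning Q T AA G RR ->
  exists2 H : coder_controller X U, admissible Q T H &
    (data_rate R Q H <= spanning_rate R T AA RR)%E.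
Proof.
move=> cover [span|triv].
  exists (spanning_coder T AA G RR); first exact: spanning_coder_admissible.
  exact: spanning_coder_rate.
have [u adm] := silent_coder_admissible triv; exists (silent_coder u) => //.
rewrite silent_data_rate; apply: spanning_rate_ge0.
by have [_ -> _] := triv; exists [:: T].
Qed.

End Admissible.

Theorem theorem1 (R : realType) (Sigma : system) (Q T : set (state Sigma))
    (TQ : T `<=` Q) :
  reachability_entropy R Q T =
  ereal_inf [set r : \bar R |
    exists2 H : coder_controller (state Sigma) (input Sigma),
      admissible Q T H & r = data_rate R Q H].
Proof.
apply/eqP; rewrite eq_le; apply/andP; split.
  apply: le_ereal_inf_tmp => _ [H adm ->].
  exact: reachability_entropy_le_data_rate.
(* If reachability is not satisfiable, the entropy is infinite and bounds everything. *)
rewrite /reachability_entropy; case: asboolP => _; last exact: leey.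
apply: le_ereal_inf_tmp => _ [AA [G [cover ->]]].
apply: le_ereal_inf_tmp => _ [RR span <-].
have [H adm le_rate] := data_rate_le_spanning_rate R TQ cover span.
by apply: le_trans le_rate; apply: ereal_inf_lbound; exists H.
Qed.
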